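(* Let $T>0$, let $b:\mathbb{R}\to\mathbb{R}$ be globally Lipschitz, and let $G_t(x)=\frac12 1_{\{|x|\le t\}}$ be the fundamental solution of the wave equation on $[0,\infty)\times\mathbb{R}$. For every $\eta\in C([0,T]\times\mathbb{R})$, the deterministic integral equation $$z(t,x)=\int_0^t\int_{\mathbb{R}}b(z(s,y))\,G_{t-s}(x-y)\,dy\,ds+\eta(t,x),\qquad (t,x)\in[0,T]\times\mathbb{R},$$ has a unique solution $z\in C([0,T]\times\mathbb{R})$. Moreover, the solution operator $F:C([0,T]\times\mathbb{R})\to C([0,T]\times\mathbb{R})$ defined by $F(\eta)=z$ is continuous when $C([0,T]\times\mathbb{R})$ is endowed with the metric of uniform convergence on compact sets.
   Context: $C([0,T]\times\mathbb{R})$ is the space of real-valued continuous functions on $[0,T]\times\mathbb{R}$. *)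

(* Defs.v *)
From HB Require Import structures.
From mathcomp Require Import all_boot all_order all_algebra.
From mathcomp Require Import all_classical all_reals all_analysis.
Import Order.TTheory GRing.Theory Num.Theory.
Import numFieldNormedType.Exports.

Set Implicit Arguments.
Unset Strict Implicit.
Unset Printing Implicit Defensive.

Local Open Scope classical_set_scope.
Local Open Scope ring_scope.

Definition strip (R : realType) (T : R) : set (R * R) :=
  `[0, T]%classic `*` [set: R].

Definition Cstrip (R : realType) (T : R) : Type :=
  continuousType (strip T) R.

Definition Cstrip_fun (R : realType) (T : R) (f : Cstrip T) : strip T -> R :=
  (f : continuousType (strip T) R).

Coercion Cstrip_fun : Cstrip >-> Funclass.

HB.instance Definition _ (R : realType) (T : R) := Choice.on (Cstrip T).

(* Continuity of the solution operator only depends on the topology of the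
   metric of uniform convergence on compact sets: [Cstrip T] is topologized as
   a subspace of the space of all functions on the strip with the topology of
   compact convergence. *)
HB.instance Definition _ (R : realType) (T : R) :=
  Uniform.copy (Cstrip T)
    (initial_topology
       (@Cstrip_fun R T : Cstrip T -> {family compact, strip T -> R})).

Definition wave_kernel (R : realType) (t x : R) : R :=
  2^-1 * \1_[set u : R | `|u| <= t] x.

(* A function on the strip is a function on a subtype of [R * R]; under the
   integral sign it is extended by [0]. The extension is only ever evaluated
   at points [(s, y)] with [0 <= s <= t <= T], which lie in the strip. *)
Definition extend0 (R : realType) (T : R) (z : strip T -> R) : R * R -> R :=
  valL_ 0 z.

Definition solves_wave_eq (R : realType) (T : R) (b : R -> R)
    (eta z : Cstrip T) : Prop :=
  forall p : strip T,
    let t := (set_val p).1 in let x := (set_val p).2 in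
    z p = (\int[lebesgue_measure]_(s in `[0, t])
             (\int[lebesgue_measure]_y
                (b (extend0 z (s, y)) * wave_kernel (t - s) (x - y))))
          + eta p.

(* Main.v *)
(* Write J h for the integral of h over the backward light cone, so that the
   equation reads z = J (b o z / 2) + eta. The trapezoids
   {0 <= t <= T, |x| + t <= N} exhaust the strip and contain the backward cones
   of their points, so on each of them estimates close up. If |h1 - h2| is at
   most E exp(l t) on a trapezoid, then |J h1 - J h2| is at most
   (2 T / l) E exp(l t) there; hence for l large the right-hand side is a
   contraction of factor 1/2 for the sup norm weighted by exp(- l t). Picard
   iterates converge geometrically on every trapezoid, which gives existence,
   and |z1 - z2| <= 2 exp(l t) sup |eta1 - eta2| gives both uniqueness and
   continuity of the solution operator. *)

Require Import Defs.
From mathcomp Require Import all_boot all_order all_algebra.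
From mathcomp Require Import all_classical all_reals all_analysis.
From mathcomp Require Import ring lra.
Import Order.TTheory GRing.Theory Num.Theory.
Import numFieldNormedType.Exports.
Local Open Scope classical_set_scope.
Local Open Scope ring_scope.

Set Implicit Arguments.
Unset Strict Implicit.

(** * Integrals over segments depending continuously on a parameter *)

(** Near [(p0, y)] both [h (p, y')] and [h (p0, y')] are within [e / 2] of [h (p0, y)]; the
    near-covering form of compactness makes the neighbourhood of [p0] independent of [y]. *)
Lemma compact_tube (R : realType) (X Y : topologicalType) (h : X * Y -> R)
    (K : set Y) (p0 : X) (e : R) :
  continuous h -> compact K -> 0 < e ->
  \forall p \near p0, forall y, K y -> `|h (p, y) - h (p0, y)| < e.
Proof.
move=> ch /compact_near_coveringP cK e0.
apply: (cK X (nbhs p0) (fun p y => `|h (p, y) - h (p0, y)| < e)) => y Ky.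
have e20 : 0 < e / 2 by rewrite divr_gt0.
have /cvgrPdist_lt/(_ _ e20) [[U V] /= [nU nV] UV] := ch (p0, y).
exists (V, U) => // -[y' p] /= [Vy' Up].
have h1 := UV (p, y') (conj Up Vy').
have h2 := UV (p0, y') (conj (nbhs_singleton nU) Vy').
rewrite /= in h1 h2.
rewrite [e]splitr; apply: le_lt_trans (ltrD h1 h2).
by rewrite [X in _ <= X + _]distrC; apply: ler_distD.
Qed.

Lemma continuous_fun_comp (X Y Z : topologicalType) (f : X -> Y) (g : Y -> Z) :
  continuous f -> continuous g -> continuous (fun x => g (f x)).
Proof. by move=> cf cg x; exact: (@continuous_comp _ _ _ f g x (cf x) (cg (f x))). Qed.

Lemma continuous_fun_pair (X Y Z : topologicalType) (f : X -> Y) (g : X -> Z) :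
  continuous f -> continuous g -> continuous (fun x => (f x, g x)).
Proof. by move=> cf cg x; apply: cvg_pair; [exact: cf|exact: cg]. Qed.

Lemma integrable_segment (R : realType) (f : R -> R) (a b : R) :
  continuous f -> lebesgue_measure.-integrable `[a, b] (EFin \o f).
Proof.
move=> cf; apply: continuous_compact_integrable; first exact: segment_compact.
exact: continuous_subspaceT.
Qed.

Lemma Rintegral_segment_cst (R : realType) (a b k : R) : a <= b ->
  \int[lebesgue_measure]_(y in `[a, b]) k = k * (b - a).
Proof.
move=> ab; rewrite Rintegral_cst//= lebesgue_measure_itv/= lte_fin.
by move: ab; rewrite le_eqVlt => /predU1P[->|->]; rewrite ?ltxx ?subrr.
Qed.

Lemma normr_Rintegral_le (R : realType) (f g : R -> R) (a b : R) :
  continuous f -> continuous g ->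
  (forall y, a <= y <= b -> `|f y| <= g y) ->
  `|\int[lebesgue_measure]_(y in `[a, b]) f y| <=
  \int[lebesgue_measure]_(y in `[a, b]) g y.
Proof.
move=> cf cg fg.
apply: (le_trans (le_normr_Rintegral _ _)) => //; first exact: integrable_segment.
apply: le_Rintegral => //.
- apply: integrable_segment; exact: continuous_fun_comp cf (@norm_continuous _ R).
- exact: integrable_segment.
Qed.

(** An affine substitution moves the endpoints into the integrand, so that continuity in moving
    endpoints reduces to a fixed domain. The case [a = b] is apart because the substitution must be
    strictly increasing. *)
Lemma Rintegral_segment_unit (R : realType) (f : R -> R) (a b : R) :
  continuous f -> a <= b ->
  \int[lebesgue_measure]_(y in `[a, b]) f y =
  (b - a) * \int[lebesgue_measure]_(u in `[0, 1]) f (a + (b - a) * u).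
Proof.
move=> cf; rewrite le_eqVlt => /predU1P[<-|ab].
  by rewrite subrr mul0r set_itv1 Rintegral_set1.
have d0 : 0 < b - a by rewrite subr_gt0.
pose F (u : R) := a + (b - a) * u.
have cF : continuous F.
  by move=> x; apply: cvgD; [exact: cvg_cst|apply: cvgM; [exact: cvg_cst|exact: cvg_id]].
have dF (x : R) : is_derive x 1 F (b - a).
  rewrite /F; apply: is_derive_eq; rewrite add0r /GRing.scale/=.
  by rewrite mul1r mulr1.
have F' : derive1 F = cst (b - a).
  by apply/funext => x; rewrite derive1E; apply: derive_val.
have F0 : F 0 = a by rewrite /F mulr0 addr0.
have F1 : F 1 = b by rewrite /F mulr1 addrC subrK.
rewrite -RintegralZl//; last first.
  exact: integrable_segment (continuous_fun_comp cF cf).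
have := @integration_by_substitution_increasing R F f 0 1 ler01.
rewrite F0 F1 F' /Rintegral => ->.
- by congr fine; apply: eq_integral => u _ /=; rewrite mulrC.
- by move=> x y _ _ xy; rewrite ltrD2l ltr_pM2l.
- by move=> x _; exact: cst_continuous.
- exact: is_cvg_cst.
- exact: is_cvg_cst.
- split; [by move=> x _; exact: ex_derive | |].
  + exact/cvg_at_right_filter/cF.
  + exact/cvg_at_left_filter/cF.
- exact: continuous_subspaceT.
Qed.


Lemma continuous_fst (X Y : topologicalType) : continuous (@fst X Y).
Proof. by move=> p; exact: cvg_fst. Qed.

Lemma continuous_snd (X Y : topologicalType) : continuous (@snd X Y).
Proof. by move=> p; exact: cvg_snd. Qed.

Lemma continuous_pair_left (X Y Z : topologicalType) (h : X * Y -> Z) (p : X) :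
  continuous h -> continuous (fun y => h (p, y)).
Proof.
move=> ch; apply: (continuous_fun_comp (f := fun y => (p, y))) ch.
by apply: continuous_fun_pair => [|y]; [exact: cst_continuous|exact: cvg_id].
Qed.

Lemma continuous_Rintegral_unit (R : realType) (X : topologicalType)
    (h : X * R -> R) : continuous h ->
  continuous (fun p => \int[lebesgue_measure]_(y in `[0, 1]) h (p, y)).
Proof.
move=> ch p0; apply/cvgrPdist_le => /= e e0.
have cy q : continuous (fun y => h (q, y)) by exact: continuous_pair_left.
have := compact_tube p0 ch (@segment_compact R 0 1) e0.
apply: filterS => p hp.
rewrite -RintegralB//; [|exact: integrable_segment..].
(* The bound [e] is rewritten as the integral of the constant [e] over the unit segment. *)
rewrite -[leRHS]mulr1 -{2}(subr0 1) -Rintegral_segment_cst ?ler01//.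
apply: normr_Rintegral_le; [|exact: cst_continuous|].
- by move=> y; apply: cvgB; exact: cy.
- by move=> y yI; rewrite distrC; apply/ltW/hp; rewrite /= in_itv.
Qed.

Lemma continuous_Rintegral_segment (R : realType) (X : topologicalType)
    (h : X * R -> R) (c d : X -> R) :
  continuous h -> continuous c -> continuous d -> (forall p, c p <= d p) ->
  continuous (fun p => \int[lebesgue_measure]_(y in `[c p, d p]) h (p, y)).
Proof.
move=> ch cc cd cled.
have -> : (fun p => \int[lebesgue_measure]_(y in `[c p, d p]) h (p, y)) =
    (fun p => (d p - c p) * \int[lebesgue_measure]_(u in `[0, 1])
                  (fun q => h (q.1, c q.1 + (d q.1 - c q.1) * q.2)) (p, u)).
  apply/funext => p; rewrite Rintegral_segment_unit//.
  exact: continuous_pair_left.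
move=> p; apply: cvgM; first by apply: cvgB; [exact: cd|exact: cc].
apply: (continuous_Rintegral_unit (h := fun q => h (q.1, c q.1 + (d q.1 - c q.1) * q.2))).
apply: (continuous_fun_comp (f := fun q : X * R =>
  (q.1, c q.1 + (d q.1 - c q.1) * q.2))) ch.
have c1 := continuous_fun_comp (@continuous_fst X R) cc.
have d1 := continuous_fun_comp (@continuous_fst X R) cd.
apply: continuous_fun_pair; first exact: continuous_fst.
move=> q; apply: cvgD; first exact: c1.
apply: cvgM; last exact: cvg_snd.
by apply: cvgB; [exact: d1|exact: c1].
Qed.

(** * Integration over backward light cones *)

Lemma Rintegral_expR (R : realType) (k l t : R) : l != 0 -> 0 <= t ->
  \int[lebesgue_measure]_(s in `[0, t]) (k * expR (l * s)) =
  k * (expR (l * t) - 1) / l.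
Proof.
move=> l0; rewrite le_eqVlt => /predU1P[<-|t0].
  by rewrite set_itv1 Rintegral_set1 mulr0 expR0 subrr mulr0 mul0r.
pose F (s : R) := k / l * expR (l * s).
have dF (x : R) : is_derive x 1 F (k * expR (l * x)).
  rewrite /F; apply: is_derive_eq; rewrite /GRing.scale/=.
  by field.
have cF : continuous F.
  move=> x; apply: differentiable_continuous; apply/derivable1_diffP.
  exact: ex_derive.
have cf : continuous (fun s : R => k * expR (l * s)).
  move=> x; apply: cvgM; first exact: cvg_cst.
  apply: (continuous_comp (f := fun s => l * s)); last exact: continuous_expR.
  by apply: cvgM; [exact: cvg_cst|exact: cvg_id].
rewrite /Rintegral (continuous_FTC2 (F := F) t0) /=.
- by rewrite /F mulr0 expR0; field.
- exact: continuous_subspaceT.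
- split; [by move=> x _; exact: ex_derive | |].
  + exact/cvg_at_right_filter/cF.
  + exact/cvg_at_left_filter/cF.
- by move=> x _; rewrite derive1E; apply: derive_val.
Qed.

(* [Num.max] and the absolute values make this a continuous function on the whole
   plane; only the values for [0 <= p.1] are meaningful. *)
Definition cone_integral (R : realType) (h : R * R -> R) (p : R * R) : R :=
  \int[lebesgue_measure]_(s in `[0, Num.max 0 p.1])
    \int[lebesgue_measure]_(y in `[p.2 - `|p.1 - s|, p.2 + `|p.1 - s|]) h (s, y).

Section cone_integral.
Variable R : realType.
Implicit Types h : R * R -> R.

Let slice h (q : (R * R) * R) : R :=
  \int[lebesgue_measure]_(y in `[q.1.2 - `|q.1.1 - q.2|, q.1.2 + `|q.1.1 - q.2|])
    h (q.2, y).

Let continuous_slice h : continuous h -> continuous (slice h).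
Proof.
move=> ch.
have c1 : continuous (fun q : (R * R) * R => q.1.2).
  exact: continuous_fun_comp (@continuous_fst _ _) (@continuous_snd _ _).
have c2 : continuous (fun q : (R * R) * R => `|q.1.1 - q.2|).
  apply: continuous_fun_comp (@norm_continuous _ R) => q; apply: cvgB.
    exact: (continuous_fun_comp (@continuous_fst _ _) (@continuous_fst _ _)).
  exact: continuous_snd.
apply: (continuous_Rintegral_segment
  (h := fun q : ((R * R) * R) * R => h (q.1.2, q.2))).
- apply: continuous_fun_comp ch; apply: continuous_fun_pair.
    exact: continuous_fun_comp (@continuous_fst _ _) (@continuous_snd _ _).
  exact: continuous_snd.
- by move=> q; apply: cvgB; [exact: c1|exact: c2].
- by move=> q; apply: cvgD; [exact: c1|exact: c2].
- by move=> q; have := normr_ge0 (q.1.1 - q.2); lra.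
Qed.

Lemma continuous_cone_integral h : continuous h -> continuous (cone_integral h).
Proof.
move=> ch; apply: (continuous_Rintegral_segment (h := slice h)).
- exact: continuous_slice.
- exact: cst_continuous.
- move=> p; apply: continuous_max; first exact: cvg_cst.
  exact: continuous_fst.
- by move=> p; rewrite le_max lexx.
Qed.

(** The cone with apex [(t, x)] has width [2 (t - s) <= 2 T] at time [s], and integrating the weight
    [exp(l s)] over [[0, t]] gains the factor [1 / l]. *)
Lemma cone_integral_dist_le h1 h2 (T N l E : R) :
  continuous h1 -> continuous h2 -> 0 < l -> 0 <= E ->
  (forall p, 0 <= p.1 <= T -> `|p.2| + p.1 <= N ->
     `|h1 p - h2 p| <= E * expR (l * p.1)) ->
  forall p, 0 <= p.1 <= T -> `|p.2| + p.1 <= N ->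
     `|cone_integral h1 p - cone_integral h2 p| <=
     2 * T / l * E * expR (l * p.1).
Proof.
move=> ch1 ch2 l0 E0 h12 [t x]/= /andP[t0 tT] xN.
rewrite /cone_integral /= (max_idPr t0).
have cs h : continuous h -> continuous (fun s => slice h ((t, x), s)).
  by move=> ch; exact: continuous_pair_left (continuous_slice ch).
rewrite -RintegralB//; [|exact: integrable_segment (cs _ ch1)|
  exact: integrable_segment (cs _ ch2)].
have ce : continuous (fun s : R => 2 * T * E * expR (l * s)).
  move=> s; apply: cvgM; first exact: cvg_cst.
  apply: (continuous_comp (f := fun s => l * s)); last exact: continuous_expR.
  by apply: cvgM; [exact: cvg_cst|exact: cvg_id].
(* The intermediate bound is the exact time integral of [2 T E exp(l s)]; the [- 1] is then
   dropped. *)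
apply: (@le_trans _ _ (2 * T * E * (expR (l * t) - 1) / l)); last first.
  rewrite -subr_ge0; set e := expR _.
  have -> : 2 * T / l * E * e - 2 * T * E * (e - 1) / l = 2 * T * E / l.
    by field; rewrite gt_eqF.
  by rewrite divr_ge0 ?(ltW l0)// !mulr_ge0// (le_trans t0).
rewrite -Rintegral_expR ?gt_eqF//.
apply: normr_Rintegral_le => //.
  by move=> s; apply: cvgB; [exact: cs|exact: cs].
move=> s /andP[s0 st]; rewrite -RintegralB//;
  [|exact: integrable_segment (continuous_pair_left ch1)
   |exact: integrable_segment (continuous_pair_left ch2)].
have ts : `|t - s| = t - s by rewrite ger0_norm ?subr_ge0.
apply: (@le_trans _ _ (\int[lebesgue_measure]_(y in `[x - `|t - s|, x + `|t - s|])
   (E * expR (l * s)))).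
  apply: normr_Rintegral_le; last first.
  (* The cone stays in the trapezoid: [|y| + s <= |x| + (t - s) + s <= N]. *)
  - move=> y; rewrite ts => /andP[y1 y2]; apply: (h12 (s, y)) => /=; first by lra.
    have x1 := ler_norm x.
    have x3 : - x <= `|x| by rewrite -normrN ler_norm.
    by rewrite -lerBrDr ler_norml; apply/andP; split; lra.
  - exact: cst_continuous.
  - by move=> y; apply: cvgB; exact: continuous_pair_left.
rewrite Rintegral_segment_cst; last by rewrite ts; lra.
rewrite ts; set e := expR _.
have e0 : 0 <= e by exact: expR_ge0.
have -> : 2 * T * E * e = E * e * (2 * T) by ring.
by rewrite ler_wpM2l ?mulr_ge0//; lra.
Qed.

End cone_integral.

(** * Clipping of time, dyadic estimates and trapezoids *)

(** Precomposing with this retraction onto [[0, T]] extends functions on the strip continuously to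
    the plane, where all the analysis takes place. *)
Definition clip (R : realType) (T t : R) : R := Num.min T (Num.max 0 t).

Lemma clip_itv (R : realType) (T t : R) : 0 <= T -> 0 <= clip T t <= T.
Proof. by move=> T0; rewrite /clip le_min T0 le_max lexx/= ge_min lexx. Qed.

Lemma clip_id (R : realType) (T t : R) : 0 <= t <= T -> clip T t = t.
Proof. by move=> /andP[t0 tT]; rewrite /clip (max_idPr t0) (min_idPr tT). Qed.

Lemma continuous_clip (R : realType) (T : R) : continuous (clip T).
Proof.
have -> : clip T = cst T \min (cst 0 \max id) by [].
move=> t; apply: continuous_min; first exact: cvg_cst.
by apply: continuous_max; [exact: cvg_cst|exact: cvg_id].
Qed.

Lemma dyadic_small (R : realType) (a e : R) : 0 < e -> exists n, a / 2 ^+ n < e.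
Proof.
move=> e0; have [n an] : exists n : nat, `|a| / e < n%:R.
  by exists (Num.truncn (`|a| / e)).+1; exact: truncnS_gt.
exists n; rewrite ltr_pdivrMr ?exprn_gt0// mulrC -ltr_pdivrMr//.
apply: le_lt_trans (lt_trans an _); last by rewrite -natrX ltr_nat ltn_expl.
by rewrite ler_wpM2r ?ler_norm// invr_ge0 ltW.
Qed.

Lemma dyadic_le0 (R : realType) (a x : R) : (forall n, x <= a / 2 ^+ n) -> x <= 0.
Proof.
move=> xa; rewrite leNgt; apply/negP => x0.
by have [n an] := dyadic_small a x0; have := xa n; rewrite leNgt an.
Qed.

(** The bound is uniform in [k], so the sequence is Cauchy and the bound survives the passage
    [k -> oo]. *)
Lemma dyadic_cauchy (R : realType) (v : nat -> R) (a : R) :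
  (forall n k, `|v (n + k)%N - v n| <= a / 2 ^+ n) ->
  forall n, `|lim (v @ \oo) - v n| <= a / 2 ^+ n.
Proof.
move=> va.
have cv : cvg (v @ \oo).
  apply/cauchy_cvgP/cauchy_exP => e e0; have [n an] := dyadic_small a e0.
  exists (v n); exists n => // m /= nm; rewrite /ball/= distrC.
  by rewrite -(subnKC nm); exact: le_lt_trans an.
move=> n; apply/ler_addgt0Pr => e e0.
have /cvgrPdist_lt/(_ _ e0)[m _ mv] := cv.
rewrite [leRHS]addrC; apply: le_trans (ler_distD (v (n + m)%N) _ _) _.
by apply: lerD (va n m); apply: ltW; apply: mv; rewrite /= leq_addl.
Qed.

(* The constraint on [|p.2| + p.1] makes this set contain the backward light cones
   of its points. *)
Definition trapezoid (R : realType) (T N : R) : set (R * R) :=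
  [set p | 0 <= p.1 <= T /\ `|p.2| + p.1 <= N].

(** Since [p.1] is nonnegative, the trapezoid lies in the compact rectangle [[0, T] x [-N, N]]. *)
Lemma trapezoid_bounded (R : realType) (T N : R) (f : R * R -> R) :
  continuous f -> exists2 C, 0 <= C & forall p, trapezoid T N p -> `|f p| <= C.
Proof.
move=> cf.
have cK : compact (`[0, T] `*` `[- N, N] : set (R * R)).
  by apply: compact_setX; exact: segment_compact.
have /compact_bounded [M [_ HM]] : compact (f @` (`[0, T] `*` `[- N, N])).
  by apply: continuous_compact => //; exact: continuous_subspaceT.
exists (`|M| + 1); first by rewrite addr_ge0.
move=> p [/andP[t0 tT] xN].
apply: HM; first by rewrite (le_lt_trans (ler_norm _))// ltrDl.
exists p => //; split => /=; rewrite in_itv/= ?t0//.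
by rewrite -ler_norml; lra.
Qed.

(** * Fixed points of a map contracting on every trapezoid *)

Section weighted_fixpoint.
Variables (R : realType) (T l : R) (Phi : (R * R -> R) -> R * R -> R).
Hypothesis l0 : 0 <= l.
Hypothesis T0 : 0 <= T.
Hypothesis continuous_Phi : forall z, continuous z -> continuous (Phi z).
(** The contraction is phrased through bounds [E] on each trapezoid, because a continuous function
    on the strip may be unbounded in [x] and have no finite global norm. *)
Hypothesis contraction_Phi : forall (N E : R) (z1 z2 : R * R -> R),
  continuous z1 -> continuous z2 -> 0 <= E ->
  (forall p, trapezoid T N p -> `|z1 p - z2 p| <= E * expR (l * p.1)) ->
  forall p, trapezoid T N p -> `|Phi z1 p - Phi z2 p| <= E / 2 * expR (l * p.1).

Let expR_ge1 N (p : R * R) : trapezoid T N p -> 1 <= expR (l * p.1).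
Proof. by case=> /andP[p0 _] _; rewrite -expR0 ler_expR mulr_ge0. Qed.

(** The weighted distance [w] satisfies [w <= d + w / 2]. Iterating this from a crude bound [C]
    gives [2 d + C / 2 ^+ n], and [n] tends to infinity. *)
Lemma fixpoint_stability (N d : R) (eta1 eta2 z1 z2 : R * R -> R) :
  continuous z1 -> continuous z2 ->
  (forall p, trapezoid T N p -> z1 p = Phi z1 p + eta1 p) ->
  (forall p, trapezoid T N p -> z2 p = Phi z2 p + eta2 p) ->
  0 <= d -> (forall p, trapezoid T N p -> `|eta1 p - eta2 p| <= d) ->
  forall p, trapezoid T N p -> `|z1 p - z2 p| <= 2 * d * expR (l * p.1).
Proof.
move=> cz1 cz2 ez1 ez2 d0 ed.
have [C C0 zC] : exists2 C, 0 <= C &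
    forall p, trapezoid T N p -> `|z1 p - z2 p| <= C.
  by apply: trapezoid_bounded => p; apply: cvgB; [exact: cz1|exact: cz2].
have step n p : trapezoid T N p ->
    `|z1 p - z2 p| <= (2 * d + C / 2 ^+ n) * expR (l * p.1).
  elim: n p => [|n IH] p Dp.
    rewrite expr0 divr1; apply: le_trans (zC _ Dp) _.
    by rewrite -[leLHS]mulr1 ler_pM ?lerDr ?mulr_ge0//; exact: expR_ge1 Dp.
  have E0 : 0 <= 2 * d + C / 2 ^+ n.
    by rewrite addr_ge0 ?mulr_ge0// invr_ge0 exprn_ge0.
  have h := contraction_Phi cz1 cz2 E0 IH Dp.
  rewrite ez1// ez2//.
  have -> : Phi z1 p + eta1 p - (Phi z2 p + eta2 p) =
    (Phi z1 p - Phi z2 p) + (eta1 p - eta2 p) by ring.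
  apply: le_trans (ler_normD _ _) _; apply: le_trans (lerD h (ed _ Dp)) _.
  rewrite exprSr invfM mulrA.
  (* As the weight is at least 1, the unweighted [d] is absorbed into [d * e]. *)
  have := expR_ge1 Dp; set e := expR _; set k := C / _ => e1.
  nra.
move=> p Dp; rewrite -subr_le0; apply: (@dyadic_le0 _ (C * expR (l * p.1))) => n.
by have := step n p Dp; rewrite mulrDl mulrAC; lra.
Qed.

(* Picard iterates are only controlled for [0 <= t <= T], so the limit is taken
   along the retraction [clip] to get a continuous function on the whole plane. *)
Lemma fixpoint_exists (eta : R * R -> R) : continuous eta ->
  exists2 z, continuous z &
    forall p, 0 <= p.1 <= T -> z p = Phi z p + eta p.
Proof.
move=> ceta.
pose u := fix u n := if n is m.+1 then fun p => Phi (u m) p + eta p else eta.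
have cu n : continuous (u n).
  by elim: n => //= n IH p; apply: cvgD; [exact: continuous_Phi|exact: ceta].
have u_dist N : exists2 C, 0 <= C & forall n k p, trapezoid T N p ->
    `|u (n + k)%N p - u n p| <= C / 2 ^+ n * expR (l * p.1).
  have [C C0 uC] : exists2 C, 0 <= C &
      forall p, trapezoid T N p -> `|u 1%N p - u 0%N p| <= C.
    by apply: trapezoid_bounded => p; apply: cvgB; exact: cu.
  have pos n : 0 <= C / 2 ^+ n by rewrite divr_ge0// exprn_ge0.
  have step n p : trapezoid T N p ->
      `|u n.+1 p - u n p| <= C / 2 ^+ n * expR (l * p.1).
    elim: n p => [|n IH] p Dp.
      rewrite expr0 divr1; apply: le_trans (uC _ Dp) _.
      by rewrite ler_peMr//; exact: expR_ge1 Dp.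
    have := contraction_Phi (cu n.+1) (cu n) (pos n) IH Dp.
    rewrite exprSr invfM mulrA; apply: le_trans.
    by rewrite /= opprD addrACA subrr addr0.
  (* The geometric tail of [C / 2 ^+ j] from [j = n] on sums to [2 C / 2 ^+ n]. *)
  exists (2 * C); first by rewrite mulr_ge0.
  move=> n k p Dp.
  (* The exact partial sum of the geometric series makes the induction on [k] close. *)
  suff : `|u (n + k)%N p - u n p| <=
      (2 * C / 2 ^+ n - 2 * C / 2 ^+ (n + k)) * expR (l * p.1).
    move=> /le_trans; apply; rewrite ler_wpM2r ?expR_ge0// gerBl.
    by rewrite divr_ge0 ?mulr_ge0// exprn_ge0.
  elim: k => [|k IH]; first by rewrite addn0 !subrr normr0 mul0r.
  rewrite addnS; apply: le_trans (ler_distD (u (n + k)%N p) _ _) _.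
  apply: le_trans (lerD (step _ _ Dp) IH) _.
  rewrite -mulrDl ler_wpM2r ?expR_ge0// exprSr invfM.
  by set a := (_ ^+ (n + k))^-1; set c := (_ ^+ n)^-1; lra.
have clipP t : 0 <= clip T t <= T by exact: clip_itv.
have cclip : continuous (fun p : R * R => (clip T p.1, p.2)).
  apply: continuous_fun_pair; last exact: continuous_snd.
  exact: continuous_fun_comp (@continuous_fst _ _) (@continuous_clip R T).
have clipD (N : R) p : `|p.2| + T <= N -> trapezoid T N (clip T p.1, p.2).
  by move=> pN; split => //=; have /andP[] := clipP p.1; lra.
pose z p := lim ((fun n => u n (clip T p.1, p.2)) @ \oo).
have z_dist N : exists2 C, 0 <= C & forall n p, `|p.2| + T <= N ->
    `|z p - u n (clip T p.1, p.2)| <= C / 2 ^+ n * expR (l * clip T p.1).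
  have [C C0 uC] := u_dist N; exists C => // n p pN.
  rewrite mulrAC.
  apply: (@dyadic_cauchy _ (fun n => u n (clip T p.1, p.2))) => m k.
  by rewrite mulrAC; apply: uC (clipD _ _ pN).
have cz : continuous z.
  move=> p0; apply/cvgrPdist_le => /= e e0.
  (* This size covers all [p] with [|p.2| < |p0.2| + 1] after clipping, so the convergence is
     uniform near [p0]; an [e / 3] argument follows. *)
  have [C C0 zC] := z_dist (`|p0.2| + 1 + T).
  have zCe n p : `|p.2| < `|p0.2| + 1 ->
      `|z p - u n (clip T p.1, p.2)| <= C * expR (l * T) / 2 ^+ n.
    move=> pp0; apply: le_trans (zC n p _) _; first by rewrite lerD2r ltW.
    rewrite mulrAC ler_wpM2r ?invr_ge0 ?exprn_ge0// ler_wpM2l// ler_expR.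
    by rewrite ler_wpM2l//; case/andP: (clipP p.1).
  have e30 : 0 < e / 3 by rewrite divr_gt0.
  have [n ne] := dyadic_small (C * expR (l * T)) e30.
  have cun := continuous_fun_comp cclip (cu n).
  have /cvgrPdist_le/(_ _ e30) un := cun p0.
  have np0 : \forall p \near p0, `|p.2| < `|p0.2| + 1.
    have c2 : continuous (fun p : R * R => `|p.2|).
      exact: continuous_fun_comp (@continuous_snd _ _) (@norm_continuous _ R).
    have /cvgr_lt := c2 p0; apply; by rewrite ltrDl.
  near=> p.
  have h0 : `|z p0 - u n (clip T p0.1, p0.2)| <= e / 3.
    by apply: le_trans (zCe n _ _) (ltW ne); rewrite ltrDl.
  have h1 : `|z p - u n (clip T p.1, p.2)| <= e / 3.
    by apply: le_trans (zCe n _ _) (ltW ne); near: p.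
  have h2 : `|u n (clip T p0.1, p0.2) - u n (clip T p.1, p.2)| <= e / 3.
    by near: p.
  rewrite distrC in h1.
  have -> : z p0 - z p = (z p0 - u n (clip T p0.1, p0.2)) +
    ((u n (clip T p0.1, p0.2) - u n (clip T p.1, p.2)) +
     (u n (clip T p.1, p.2) - z p)) by ring.
  apply: le_trans (ler_normD _ _) _.
  apply: le_trans (lerD h0 (le_trans (ler_normD _ _) (lerD h2 h1))) _.
  lra.
exists z => // -[t x] /= tT.
have Dp : trapezoid T (`|x| + T) (t, x).
  by split => //=; case/andP: tT => _ tT; rewrite lerD2l.
(* The second [T] is there because [z_dist] requires [|p.2| + T] below the size, while points of the
   trapezoid of size [|x| + T] only satisfy [|p.2| <= |x| + T]. *)
have [C C0 zC] := z_dist (`|x| + T + T).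
have zu n p : trapezoid T (`|x| + T) p ->
    `|z p - u n p| <= C / 2 ^+ n * expR (l * p.1).
  move=> -[pT pN]; have := zC n p; rewrite clip_id// -surjective_pairing; apply.
  by case/andP: pT => p0 _; rewrite lerD2r; lra.
apply/eqP; rewrite -subr_eq0 -normr_le0.
apply: (@dyadic_le0 _ (2 * C * expR (l * t))) => n.
have E0 : 0 <= C / 2 ^+ n by rewrite divr_ge0// exprn_ge0.
have h1 := zu n.+1 _ Dp.
have h2 := contraction_Phi cz (cu n) E0 (zu n) Dp.
rewrite /= in h1 h2; rewrite distrC in h2.
(* Both sides of the equation are compared with [u n.+1], which is [Phi (u n) + eta]. *)
have -> : z (t, x) - (Phi z (t, x) + eta (t, x)) =
  (z (t, x) - (Phi (u n) (t, x) + eta (t, x))) +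
  (Phi (u n) (t, x) - Phi z (t, x)) by ring.
apply: le_trans (ler_normD _ _) _; apply: le_trans (lerD h1 h2) _.
rewrite exprSr invfM mulrA -mulrDl -splitr.
have -> : 2 * C * expR (l * t) / 2 ^+ n = 2 * (C / 2 ^+ n * expR (l * t)).
  by rewrite -!mulrA [_^-1 * _]mulrC.
by rewrite ler_peMl ?ler1n// mulr_ge0// expR_ge0.
Unshelve. all: by end_near. Qed.
End weighted_fixpoint.

(** * The wave operator is a weighted contraction *)

Definition wave_op (R : realType) (b : R -> R) (z : R * R -> R) : R * R -> R :=
  cone_integral (fun q => b (z q) * 2^-1).

Section wave_op.
Variables (R : realType) (b : R -> R) (L : R).
Hypothesis L0 : 0 <= L.
Hypothesis b_lip : forall u v, `|b u - b v| <= L * `|u - v|.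

Let continuous_b : continuous b.
Proof.
move=> u; apply/cvgrPdist_le => e e0; near=> v.
apply: le_trans (b_lip _ _) _.
(* The constant is enlarged to [L + 1] to allow division when [L = 0]. *)
apply: (@le_trans _ _ ((L + 1) * `|u - v|)).
  by rewrite ler_wpM2r// lerDl.
rewrite -ler_pdivlMl ?ltr_pwDr//.
near: v; apply: cvgr_dist_le; first exact: cvg_id.
by rewrite mulr_gt0// invr_gt0 ltr_pwDr.
Unshelve. all: by end_near. Qed.

Let continuous_source z : continuous z -> continuous (fun q : R * R => b (z q) * 2^-1).
Proof.
move=> cz q; apply: cvgM; last exact: cvg_cst.
exact: (continuous_fun_comp cz continuous_b).
Qed.

Lemma continuous_wave_op z : continuous z -> continuous (wave_op b z).
Proof. by move=> cz; exact/continuous_cone_integral/continuous_source. Qed.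

(** The cone estimate gives the factor [(2 T / l) (L / 2) = L T / l]. With [l = 2 L T + 1] it is at
    most [1 / 2], and the [+ 1] keeps [l] positive. *)
Lemma wave_op_contraction (T N E : R) (z1 z2 : R * R -> R) :
  0 <= T ->
  continuous z1 -> continuous z2 -> 0 <= E ->
  (forall p, trapezoid T N p ->
     `|z1 p - z2 p| <= E * expR ((2 * L * T + 1) * p.1)) ->
  forall p, trapezoid T N p ->
    `|wave_op b z1 p - wave_op b z2 p| <= E / 2 * expR ((2 * L * T + 1) * p.1).
Proof.
move=> T0 cz1 cz2 E0 zE p [pT pN].
set l := 2 * L * T + 1 in zE *.
have LT0 : 0 <= L * T by rewrite mulr_ge0.
have l0 : 0 < l by rewrite /l; lra.
have LE0 : 0 <= L * E / 2 by rewrite divr_ge0 ?mulr_ge0.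
have := cone_integral_dist_le (T := T) (N := N)
  (continuous_source cz1) (continuous_source cz2) l0 LE0.
move=> /(_ _ p pT pN)/le_trans; apply.
- move=> q qT qN; rewrite -mulrBl normrM [`|2^-1|]ger0_norm ?invr_ge0//.
  have -> : L * E / 2 * expR (l * q.1) = L * (E * expR (l * q.1)) * 2^-1.
    by rewrite -!mulrA [2^-1 * _]mulrC.
  rewrite ler_wpM2r ?invr_ge0//; apply: le_trans (b_lip _ _) _.
  by rewrite ler_wpM2l// zE.
- rewrite ler_wpM2r ?expR_ge0//.
  have -> : 2 * T / l * (L * E / 2) = (2 * (L * T)) / l * (E / 2).
    by field; rewrite gt_eqF.
  rewrite -[leRHS]mul1r ler_wpM2r ?divr_ge0// ler_pdivrMr// mul1r /l; lra.
Qed.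
End wave_op.

(** * From functions on the strip to functions on the plane *)

Section strip.
Variables (R : realType) (T : R).
Hypothesis T0 : 0 <= T.

Lemma clip_strip (p : R * R) : (clip T p.1, p.2) \in strip T.
Proof. by apply/mem_set; split => //=; rewrite in_itv/= clip_itv. Qed.

Definition strip_retract (p : R * R) : strip T :=
  exist (fun q => q \in strip T) _ (clip_strip p).

Lemma strip_retract_val (q : strip T) : strip_retract (set_val q) = q.
Proof.
apply: val_inj => /=; rewrite clip_id -?surjective_pairing//.
by have [] := set_valP q; rewrite /= in_itv.
Qed.

Lemma continuous_strip_retract : continuous strip_retract.
Proof.
apply: (@continuous_comp_initial _ _ _ set_val).
apply: (continuous_fun_pair (f := fun p => clip T p.1) (g := snd)).
  exact: continuous_fun_comp (@continuous_fst _ _) (@continuous_clip R T).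
exact: continuous_snd.
Qed.

(** This extension is continuous on the whole plane, whereas [extend0] need not be so at the
    boundary of the strip; they agree on the strip. *)
Definition strip_extend (z : Cstrip T) (p : R * R) : R := z (strip_retract p).

Lemma continuous_strip_extend z : continuous (strip_extend z).
Proof.
apply: continuous_fun_comp continuous_strip_retract _.
exact: (@cts_fun _ _ (z : continuousType (strip T) R)).
Qed.

Lemma continuous_set_val : continuous (set_val : strip T -> R * R).
Proof. exact: initial_continuous. Qed.

Lemma extend0E (z : Cstrip T) (p : R * R) : 0 <= p.1 <= T ->
  extend0 z p = strip_extend z p.
Proof.
move=> pT; have ps : p \in strip T by apply/mem_set; split => //=; rewrite in_itv.
have -> : p = set_val (exist (fun q => q \in strip T) p ps : strip T) by [].
rewrite /strip_extend strip_retract_val.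
set q := exist _ _ _; exact: (congr1 (fun f => f q) (valLK 0 (z : strip T -> R))).
Qed.

(** The indicator in the kernel becomes a restriction, which turns the integral over the line into
    one over a section of the cone. *)
Lemma wave_kernel_restrict (f : R -> R) (r x : R) :
  (fun y => f y * wave_kernel r (x - y)) =
  (fun y => f y * 2^-1) \_ `[x - r, x + r].
Proof.
apply/funext => y; rewrite patchE /wave_kernel indicE.
have -> : (y \in `[x - r, x + r]%classic) = (`|x - y| <= r).
  rewrite mem_setE in_itv/= ler_norml.
  by apply/andP/andP => -[h1 h2]; split; lra.
have -> : (x - y \in [set u | `|u| <= r]) = (`|x - y| <= r).
  by rewrite mem_setE.
by case: ifP => _; rewrite ?mulr1 ?mulr0.
Qed.

Lemma wave_integralE (b : R -> R) (z : Cstrip T) (t x : R) : 0 <= t <= T ->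
  \int[lebesgue_measure]_(s in `[0, t])
    (\int[lebesgue_measure]_y
       (b (extend0 z (s, y)) * wave_kernel (t - s) (x - y))) =
  wave_op b (strip_extend z) (t, x).
Proof.
move=> /andP[t0 tT]; rewrite /wave_op /cone_integral /= (max_idPr t0).
apply: eq_Rintegral => s; rewrite inE/= in_itv/= => /andP[s0 st].
rewrite (wave_kernel_restrict (fun y => b (extend0 z (s, y)))).
rewrite -Rintegral_mkcond ger0_norm ?subr_ge0//.
by apply: eq_Rintegral => y _; rewrite extend0E//= s0 (le_trans st).
Qed.

Lemma solves_wave_eqP (b : R -> R) (eta z : Cstrip T) :
  solves_wave_eq b eta z <->
  forall p, 0 <= p.1 <= T ->
    strip_extend z p = wave_op b (strip_extend z) p + strip_extend eta p.
Proof.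
split=> [H p pT|H q /=].
  have := H (strip_retract p); rewrite /= wave_integralE; last exact: clip_itv.
  by rewrite clip_id// -surjective_pairing.
have [qT _] := set_valP q; rewrite /= in_itv in qT.
rewrite wave_integralE// -surjective_pairing.
by have := H _ qT; rewrite /strip_extend strip_retract_val.
Qed.
End strip.

(** * Compact convergence expressed by epsilons *)

Lemma continuous_Cstrip_fun (R : realType) (T : R) :
  continuous (@Cstrip_fun R T : Cstrip T -> {family compact, strip T -> R}).
Proof. exact: initial_continuous. Qed.

Lemma Cstrip_near (R : realType) (T : R) (A : set (strip T)) (eta : Cstrip T) (d : R) :
  compact A -> 0 < d ->
  nbhs eta [set eta' : Cstrip T | forall q, A q -> `|eta q - eta' q| < d].
Proof.
move=> cA d0; have := @continuous_Cstrip_fun R T eta.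
move=> /fam_cvgP /(_ _ cA).
move=> /(_ _ [set h : strip T -> R | forall q, A q -> `|eta q - h q| < d]); apply.
  exact/fmap_filter/nbhs_filter.
apply/uniform_nbhs; exists [set xy | ball xy.1 d xy.2]; split => //.
exact: entourage_ball (PosNum d0).
Qed.

Lemma continuous_to_Cstrip (R : realType) (T : R) (X : topologicalType)
    (F : X -> Cstrip T) :
  (forall A, compact A -> forall x e, 0 < e ->
     \forall x' \near x, forall q, A q -> `|F x q - F x' q| < e) ->
  continuous F.
Proof.
move=> HF; apply: (continuous_comp_initial (w := @Cstrip_fun R T :
  Cstrip T -> {family compact, strip T -> R})).
move=> x; apply/fam_cvgP => A cA P /uniform_nbhs[E []].
rewrite -entourage_ballE => -[e /= e0 eE] EP.
have := HF A cA x e e0; apply: filterS => x' Hx'.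
by apply: EP => q Aq; apply: eE; exact: Hx'.
Qed.

Lemma lipschitz_ex (R : realType) (b : R -> R) : lipschitz b ->
  exists2 L, 0 <= L & forall u v, `|b u - b v| <= L * `|u - v|.
Proof.
(* [lipschitz] supplies the estimate for every constant beyond a threshold [M]; this one is also
   nonnegative. *)
move=> [M [_ HM]]; exists (`|M| + 1) => [|u v]; first by rewrite addr_ge0.
have M1 : M < `|M| + 1 by rewrite (le_lt_trans (ler_norm _))// ltrDl.
exact: (HM _ M1 (u, v)).
Qed.

(** * Existence, uniqueness and continuous dependence *)

Section solutions.
Variables (R : realType) (T : R) (b : R -> R) (L : R).
Hypothesis T0 : 0 <= T.
Hypothesis L0 : 0 <= L.
Hypothesis b_lip : forall u v, `|b u - b v| <= L * `|u - v|.

Let l := 2 * L * T + 1.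

Let l0 : 0 <= l.
Proof. by rewrite /l addr_ge0// mulr_ge0// mulr_ge0. Qed.

Lemma solution_dist_le (N d : R) (eta1 eta2 z1 z2 : Cstrip T) :
  solves_wave_eq b eta1 z1 -> solves_wave_eq b eta2 z2 -> 0 <= d ->
  (forall p, trapezoid T N p ->
     `|strip_extend T0 eta1 p - strip_extend T0 eta2 p| <= d) ->
  forall p, trapezoid T N p ->
    `|strip_extend T0 z1 p - strip_extend T0 z2 p| <= 2 * d * expR (l * p.1).
Proof.
move=> /(solves_wave_eqP T0) ez1 /(solves_wave_eqP T0) ez2.
apply: (fixpoint_stability (Phi := wave_op b)) => //.
- by move=> N' E u1 u2 cu1 cu2; exact: wave_op_contraction.
- exact: continuous_strip_extend.
- exact: continuous_strip_extend.
- by move=> p [pT _]; exact: ez1.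
- by move=> p [pT _]; exact: ez2.
Qed.

Lemma solution_exists (eta : Cstrip T) : exists z, solves_wave_eq b eta z.
Proof.
have contr N E u1 u2 := @wave_op_contraction R b L L0 b_lip T N E u1 u2 T0.
have [z cz ez] := fixpoint_exists l0 T0 (continuous_wave_op L0 b_lip) contr
  (@continuous_strip_extend R T T0 eta).
have czr : continuous (z \o (set_val : strip T -> R * R)).
  exact: continuous_fun_comp (@continuous_set_val R T) cz.
pose zr : Cstrip T := (mkcts czr : continuousType (strip T) R).
have zrE p : 0 <= p.1 <= T -> strip_extend T0 zr p = z p.
  move=> pT; transitivity (z (clip T p.1, p.2)); first by [].
  by rewrite clip_id// -surjective_pairing.
exists zr; apply/(solves_wave_eqP T0) => p pT.
(* [z] and the extension of [zr] may differ outside the strip. The contraction estimate with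
   [E := 0] shows that [wave_op] on the strip sees only values there. *)
rewrite zrE// ez//; congr (_ + _); apply/eqP; rewrite -subr_eq0 -normr_le0.
have Dp : trapezoid T (`|p.2| + p.1) p by [].
have := wave_op_contraction (E := 0) L0 b_lip T0 cz
  (@continuous_strip_extend _ _ T0 zr) (lexx _) _ Dp.
rewrite !mul0r; apply => q [qT _].
by rewrite mul0r zrE// subrr normr0.
Qed.

Lemma solution_unique (eta z1 z2 : Cstrip T) :
  solves_wave_eq b eta z1 -> solves_wave_eq b eta z2 -> z1 = z2.
Proof.
move=> ez1 ez2; apply/continuousEP => q.
have [qT _] := set_valP q; rewrite /= in_itv in qT.
have Dq : trapezoid T (`|(set_val q).2| + (set_val q).1) (set_val q) by [].
have := solution_dist_le ez1 ez2 (lexx 0) _ Dq.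
rewrite mulr0 mul0r normr_le0 subr_eq0 /strip_extend strip_retract_val => H.
by apply/eqP/H => p _; rewrite subrr normr0.
Qed.

(** Solutions on a compact [A] depend on the data over the backward cones from [A], so closeness of
    the data is asked on a larger compact containing a trapezoid around [A]. *)
Lemma solution_op_continuous (F : Cstrip T -> Cstrip T) :
  (forall eta, solves_wave_eq b eta (F eta)) -> continuous F.
Proof.
move=> FP; apply: continuous_to_Cstrip => A cA eta e e0.
have [N NA] : exists N, forall q, A q -> trapezoid T N (set_val q).
  have cf : continuous (fun q : strip T => `|(set_val q).2| + (set_val q).1).
    apply: (continuous_fun_comp (g := fun p : R * R => `|p.2| + p.1))
      (@continuous_set_val R T) _ => p.
    apply: cvgD; last exact: cvg_fst.
    exact: (continuous_fun_comp (@continuous_snd _ _) (@norm_continuous _ R)).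
  have /compact_bounded[M [_ HM]] := continuous_compact (continuous_subspaceT cf) cA.
  exists (`|M| + 1) => q Aq; split.
    by have [qT _] := set_valP q; rewrite /= in_itv in qT.
  apply: le_trans (ler_norm _) _.
  apply: (HM (`|M| + 1)); first by rewrite (le_lt_trans (ler_norm _))// ltrDl.
  by exists q.
pose B := strip_retract T0 @` (`[0, T] `*` `[- N, N]).
have cB : compact B.
  apply: continuous_compact.
    exact/continuous_subspaceT/continuous_strip_retract.
  by apply: compact_setX; exact: segment_compact.
(* Chosen so that [2 d exp(l T) = e / 2], strictly below [e], since the stability estimate is a weak
   inequality. *)
pose d := e / 2 / 2 / expR (l * T).
have d0 : 0 < d by rewrite !divr_gt0 ?expR_gt0.
have := Cstrip_near eta cB d0; apply: filterS => eta' H q Aq.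
have Dq := NA q Aq.
have etad p : trapezoid T N p ->
    `|strip_extend T0 eta p - strip_extend T0 eta' p| <= d.
  move=> -[/andP[p0 pT] pN]; apply/ltW/H; exists p => //; split => /=.
    by rewrite in_itv/= p0.
  by rewrite in_itv/= -ler_norml; lra.
have := solution_dist_le (FP eta) (FP eta') (ltW d0) etad Dq.
rewrite /strip_extend strip_retract_val => /le_lt_trans; apply.
apply: (@le_lt_trans _ _ (2 * d * expR (l * T))).
  have [/andP[_ qT] _] := Dq.
  apply: ler_wpM2l; first by rewrite mulr_ge0 ?(ltW d0).
  by rewrite ler_expR; apply: ler_wpM2l.
have -> : 2 * d * expR (l * T) = e / 2 by rewrite /d; field; rewrite gt_eqF ?expR_gt0.
by rewrite ltr_pdivrMr// ltr_pMr// ltr1n.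
Qed.
End solutions.

Theorem theorem4p3 (R : realType) (T : R) (T_gt0 : 0 < T)
    (b : R -> R) (b_lip : lipschitz b) :
  (forall eta : Cstrip T, exists! z : Cstrip T, solves_wave_eq b eta z) /\
  (exists F : Cstrip T -> Cstrip T,
     (forall eta : Cstrip T, solves_wave_eq b eta (F eta)) /\ continuous F).
Proof.
have [L L0 bL] := lipschitz_ex b_lip; have T0 := ltW T_gt0.
split.
  move=> eta; have [z ez] := solution_exists T0 L0 bL eta; exists z; split => //.
  by move=> z' ez'; exact: (solution_unique T0 L0 bL ez ez').
have /choice[F FP] := solution_exists T0 L0 bL.
by exists F; split => //; exact: (solution_op_continuous T0 L0 bL FP).
Qed.
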